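(* Let $\kappa,\beta>0$, let $V:\mathbb{R}^2\to\mathbb{R}$, $V=V(p,q)$, be smooth, and let $f:\mathbb{C}\to\mathbb{C}$ be given by $\mathrm{Re}\, f(p+iq)=\frac{\partial V}{\partial p}(p,q)$, $\mathrm{Im}\, f(p+iq)=\frac{\partial V}{\partial q}(p,q)$. Let $u=u(x,t)$ be a smooth complex-valued solution of $$\kappa u_{tt}+iu_t+\beta u_{xx}+f(u)=0,$$ and write $u=p+iq$, $v=p_x$, $w=q_x$, $\phi=p_t$, $\varphi=q_t$. Then the local energy and momentum conservation laws $$\mathfrak{E}_t+\mathfrak{F}_x=0,\qquad \mathfrak{I}_t+\mathfrak{M}_x=0$$ hold, where $$\mathfrak{E}=V(p,q)+\kappa\,\frac{\phi^2+\varphi^2}{2}+\frac{\beta}{2}(pv_x+qw_x),$$ $$\mathfrak{F}=\frac{\beta}{2}\left(v\phi+w\varphi-pv_t-qw_t\right),$$ $$\mathfrak{I}=\frac{\kappa}{2}\left(-p\phi_x-q\varphi_x+v\phi+w\varphi\right)+\frac12(pq_x-qp_x),$$ $$\mathfrak{M}=V(p,q)+\beta\,\frac{v^2+w^2}{2}-\frac12\left(p\varphi-q\phi-\kappa(p\phi_t+q\varphi_t)\right).$$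
   Context: All functions $p,q,v,w,\phi,\varphi$ are real-valued functions of $(x,t)$; subscripts $x,t$ denote partial derivatives. *)

(* Defs.v *)
From Stdlib Require Import Reals.
From Coquelicot Require Import Coquelicot.
Open Scope R_scope.

(* The first argument of a function of two variables is x, the second is t. *)
Definition partial_x (g : R -> R -> R) (x t : R) : R := Derive (fun y => g y t) x.
Definition partial_t (g : R -> R -> R) (x t : R) : R := Derive (fun s => g x s) t.

(* Partial derivatives of a complex-valued function of two real variables.
   Coquelicot's [C_derive] is the derivative in a complex variable, so these
   are taken componentwise; [is_derive_Cpartial_x] and [is_derive_Cpartial_t] relate them to
   [is_derive] for the real normed module C. *)
Definition Cpartial_x (u : R -> R -> C) (x t : R) : C :=
  (partial_x (fun y s => Re (u y s)) x t, partial_x (fun y s => Im (u y s)) x t).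
Definition Cpartial_t (u : R -> R -> C) (x t : R) : C :=
  (partial_t (fun y s => Re (u y s)) x t, partial_t (fun y s => Im (u y s)) x t).

Lemma is_derive_comp_C (g : R -> C) (s : R) (l : C) :
  is_derive (K := R_AbsRing) (V := C_R_NormedModule) g s l ->
  (Derive (fun r => Re (g r)) s, Derive (fun r => Im (g r)) s) = l.
Proof.
  intros H; destruct l as [a b]; f_equal; apply is_derive_unique.
  - exact (filterdiff_comp' g fst s _ fst H
             (filterdiff_linear fst is_linear_fst)).
  - exact (filterdiff_comp' g snd s _ snd H
             (filterdiff_linear snd is_linear_snd)).
Qed.

Lemma is_derive_Cpartial_x (u : R -> R -> C) (x t : R) (l : C) :
  is_derive (K := R_AbsRing) (V := C_R_NormedModule) (fun y => u y t) x l ->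
  Cpartial_x u x t = l.
Proof. exact (is_derive_comp_C (fun y => u y t) x l). Qed.

Lemma is_derive_Cpartial_t (u : R -> R -> C) (x t : R) (l : C) :
  is_derive (K := R_AbsRing) (V := C_R_NormedModule) (fun s => u x s) t l ->
  Cpartial_t u x t = l.
Proof. exact (is_derive_comp_C (fun s => u x s) t l). Qed.

(* C^infinity on D: [ex_diff_n g n x y] says that all iterated partial
   derivatives of g of order at most n exist and are continuous at (x, y).
   Meant for open D. *)
Definition smooth_on (D : R * R -> Prop) (g : R -> R -> R) : Prop :=
  forall (n : nat) (x y : R), D (x, y) -> ex_diff_n g n x y.

Definition Csmooth_on (D : R * R -> Prop) (u : R -> R -> C) : Prop :=
  smooth_on D (fun x t => Re (u x t)) /\ smooth_on D (fun x t => Im (u x t)).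

(* A_t + B_x = 0 on D. Since [Derive] is total, the existence of the two
   derivatives is part of the law. *)
Definition conservation_law (D : R * R -> Prop) (A B : R -> R -> R) : Prop :=
  forall x t : R, D (x, t) ->
    ex_derive (fun s => A x s) t /\ ex_derive (fun y => B y t) x /\
    partial_t A x t + partial_x B x t = 0.

(* Main.v *)
Require Import Defs.
From Stdlib Require Import Reals Lra.
From Coquelicot Require Import Coquelicot.
Open Scope R_scope.

(** Both laws are Noether identities: the real part of the equation times the
    conjugate of [u_t] (energy) or of [u_x] (momentum) is a divergence.
    In real form the equation is [kappa p_tt - q_t + beta p_xx + V_p = 0]
    and [kappa q_tt + p_t + beta q_xx + V_q = 0]; call the two left-hand sides
    [P] and [Q].  Expanding the derivatives with the chain rule for [V (p, q)]
    and cancelling the mixed derivatives of second and third order gives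

      [E_t + F_x = p_t P + q_t Q]   and   [I_t + M_x = p_x P + q_x Q],

    where the first-order terms contribute [- p_t q_t + q_t p_t = 0] to the
    former, and to the latter the bracket [p_t q_x - q_t p_x] produced by the
    term [(p q_x - q p_x) / 2] of [I] and the term [- (p q_t - q p_t) / 2] of
    [M].

    These balances are [energy_conservation] and [momentum_conservation].  The
    analytic content is the symmetry of mixed partial derivatives on the open
    set ([smooth_on_mixed_partials], used for [p], [q] and their first
    derivatives) and the chain rule for the potential
    ([is_derive_comp_smooth]); the decomposition of the equation into real and
    imaginary parts is [wave_equation_real_system]. *)

(** * Calculus of smooth functions of two variables *)

Lemma smooth_on_partial_x (D : R * R -> Prop) (g : R -> R -> R) :
  smooth_on D g -> smooth_on D (partial_x g).
Proof.
  intros g_smooth n x t Dxt.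
  exact (proj1 (proj2 (proj2 (proj2 (g_smooth (S n) x t Dxt))))).
Qed.

Lemma smooth_on_partial_t (D : R * R -> Prop) (g : R -> R -> R) :
  smooth_on D g -> smooth_on D (partial_t g).
Proof.
  intros g_smooth n x t Dxt.
  exact (proj2 (proj2 (proj2 (proj2 (g_smooth (S n) x t Dxt))))).
Qed.

Lemma smooth_on_continuity (D : R * R -> Prop) (g : R -> R -> R) (x t : R) :
  smooth_on D g -> D (x, t) -> continuity_2d_pt g x t.
Proof. intros g_smooth Dxt; exact (proj1 (g_smooth 0%nat x t Dxt)). Qed.

Lemma smooth_on_ex_derive_x (D : R * R -> Prop) (g : R -> R -> R) (x t : R) :
  smooth_on D g -> D (x, t) -> ex_derive (fun y => g y t) x.
Proof. intros g_smooth Dxt; exact (proj1 (proj2 (g_smooth 1%nat x t Dxt))). Qed.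

Lemma smooth_on_ex_derive_t (D : R * R -> Prop) (g : R -> R -> R) (x t : R) :
  smooth_on D g -> D (x, t) -> ex_derive (fun s => g x s) t.
Proof.
  intros g_smooth Dxt; exact (proj1 (proj2 (proj2 (g_smooth 1%nat x t Dxt)))).
Qed.

Create HintDb smooth.
#[local] Hint Resolve smooth_on_partial_x smooth_on_partial_t
  smooth_on_ex_derive_x smooth_on_ex_derive_t : smooth.

Lemma smooth_on_mixed_partials (D : R * R -> Prop) (g : R -> R -> R) (x t : R) :
  open D -> smooth_on D g -> D (x, t) ->
  partial_x (partial_t g) x t = partial_t (partial_x g) x t.
Proof.
  intros D_open g_smooth Dxt; apply (Schwarz g x t).
  - apply locally_2d_locally.
    generalize (D_open (x, t) Dxt); apply filter_imp; intros [y s] Dys; simpl.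
    repeat split.
    + exact (smooth_on_ex_derive_x D g y s g_smooth Dys).
    + exact (smooth_on_ex_derive_t D g y s g_smooth Dys).
    + apply (smooth_on_ex_derive_x D (partial_t g)); eauto with smooth.
    + apply (smooth_on_ex_derive_t D (partial_x g)); eauto with smooth.
  - apply (smooth_on_continuity D (partial_x (partial_t g))); eauto with smooth.
  - apply (smooth_on_continuity D (partial_t (partial_x g))); eauto with smooth.
Qed.

(** Partial derivatives alone do not give the chain rule; continuity of
    [partial_x V] upgrades them to total differentiability. *)
Lemma is_derive_comp_smooth (V : R -> R -> R) (a b : R -> R) (s : R) :
  smooth_on (fun _ => True) V -> ex_derive a s -> ex_derive b s ->
  is_derive (fun r => V (a r) (b r)) s
    (partial_x V (a s) (b s) * Derive a s + partial_t V (a s) (b s) * Derive b s).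
Proof.
  intros V_smooth a_derive b_derive.
  apply is_derive_Reals, derivable_pt_lim_comp_2d;
    try now apply is_derive_Reals, Derive_correct.
  apply filterdiff_differentiable_pt_lim.
  apply (is_derive_filterdiff V (a s) (b s) (partial_x V)).
  - apply filter_forall; intros [y r].
    now apply Derive_correct, (smooth_on_ex_derive_x _ _ _ _ V_smooth).
  - now apply Derive_correct, (smooth_on_ex_derive_t _ _ _ _ V_smooth).
  - apply continuity_2d_pt_filterlim.
    now apply (smooth_on_continuity (fun _ => True)); eauto with smooth.
Qed.

(** * The equation in real form *)

Lemma wave_equation_real_system (kappa beta : R) (V : R -> R -> R)
  (f : C -> C) (u utt ut uxx : C)
  (Re_f : Re (f (RtoC (Re u) + Ci * RtoC (Im u))%C) = partial_x V (Re u) (Im u))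
  (Im_f : Im (f (RtoC (Re u) + Ci * RtoC (Im u))%C) = partial_t V (Re u) (Im u)) :
  (RtoC kappa * utt + Ci * ut + RtoC beta * uxx + f u)%C = RtoC 0 ->
  kappa * Re utt - Im ut + beta * Re uxx + partial_x V (Re u) (Im u) = 0 /\
  kappa * Im utt + Re ut + beta * Im uxx + partial_t V (Re u) (Im u) = 0.
Proof.
  assert (u_eq : (RtoC (Re u) + Ci * RtoC (Im u))%C = u).
  { apply injective_projections; simpl; unfold Re, Im; ring. }
  rewrite u_eq in Re_f, Im_f; intros equation; split.
  - apply (f_equal Re) in equation; rewrite <- Re_f; simpl in equation |- *.
    unfold Re, Im in *; lra.
  - apply (f_equal Im) in equation; rewrite <- Im_f; simpl in equation |- *.
    unfold Re, Im in *; lra.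
Qed.

(** * Conservation laws *)

Lemma conservation_law_intro (D : R * R -> Prop) (A B A_t B_x : R -> R -> R) :
  (forall x t, D (x, t) -> is_derive (fun s => A x s) t (A_t x t)) ->
  (forall x t, D (x, t) -> is_derive (fun y => B y t) x (B_x x t)) ->
  (forall x t, D (x, t) -> A_t x t + B_x x t = 0) ->
  conservation_law D A B.
Proof.
  intros A_derive B_derive balance x t Dxt.
  pose proof (A_derive x t Dxt) as At; pose proof (B_derive x t Dxt) as Bx.
  split; [now exists (A_t x t) | split; [now exists (B_x x t) |]].
  rewrite <- (balance x t Dxt).
  now apply f_equal2; apply is_derive_unique.
Qed.

Ltac fold_partials x t :=
  repeat match goal with
  | |- context [Derive (fun y => ?g y t) x] =>
      change (Derive (fun y => g y t) x) with (partial_x g x t)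
  | |- context [Derive (fun s => ?g x s) t] =>
      change (Derive (fun s => g x s) t) with (partial_t g x t)
  end.

(** This is the identity [E_t + F_x = p_t P + q_t Q].  It is stated for a
    density [U] with derivative [U_p p_t + U_q q_t], of which the composite
    [V (p, q)] is an instance, so that what remains to be checked is a
    polynomial identity between derivatives of [U], [p] and [q]. *)
Lemma energy_conservation (kappa beta : R) (D : R * R -> Prop)
  (p q U U_p U_q : R -> R -> R) (D_open : open D)
  (p_smooth : smooth_on D p) (q_smooth : smooth_on D q)
  (U_derive_t : forall x t, D (x, t) -> is_derive (fun s => U x s) t
     (U_p x t * partial_t p x t + U_q x t * partial_t q x t))
  (eq_p : forall x t, D (x, t) ->
     kappa * partial_t (partial_t p) x t - partial_t q x t
     + beta * partial_x (partial_x p) x t + U_p x t = 0)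
  (eq_q : forall x t, D (x, t) ->
     kappa * partial_t (partial_t q) x t + partial_t p x t
     + beta * partial_x (partial_x q) x t + U_q x t = 0) :
  conservation_law D
    (fun x t => U x t
       + kappa * ((partial_t p x t ^ 2 + partial_t q x t ^ 2) / 2)
       + beta / 2 * (p x t * partial_x (partial_x p) x t
                     + q x t * partial_x (partial_x q) x t))
    (fun x t => beta / 2 *
       (partial_x p x t * partial_t p x t + partial_x q x t * partial_t q x t
        - p x t * partial_t (partial_x p) x t
        - q x t * partial_t (partial_x q) x t)).
Proof.
  eapply conservation_law_intro.
  - intros x t Dxt; auto_derive.
    + repeat split; eauto 10 with smooth; eexists; now apply U_derive_t.
    + replace (Derive (fun s => U x s) t)
        with (U_p x t * partial_t p x t + U_q x t * partial_t q x t)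
        by (symmetry; apply is_derive_unique; now apply U_derive_t).
      reflexivity.
  - intros x t Dxt; auto_derive; [repeat split; eauto 10 with smooth | reflexivity].
  - intros x t Dxt; simpl; fold_partials x t.
    rewrite !(smooth_on_mixed_partials D) by eauto with smooth.
    transitivity
      (partial_t p x t
         * (kappa * partial_t (partial_t p) x t - partial_t q x t
            + beta * partial_x (partial_x p) x t + U_p x t)
       + partial_t q x t
         * (kappa * partial_t (partial_t q) x t + partial_t p x t
            + beta * partial_x (partial_x q) x t + U_q x t)).
    + field.
    + rewrite (eq_p x t Dxt), (eq_q x t Dxt); ring.
Qed.

(** This is the identity [I_t + M_x = p_x P + q_x Q]; the [x]-derivative of the
    density [U] enters because the potential sits in the flux. *)
Lemma momentum_conservation (kappa beta : R) (D : R * R -> Prop)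
  (p q U U_p U_q : R -> R -> R) (D_open : open D)
  (p_smooth : smooth_on D p) (q_smooth : smooth_on D q)
  (U_derive_x : forall x t, D (x, t) -> is_derive (fun y => U y t) x
     (U_p x t * partial_x p x t + U_q x t * partial_x q x t))
  (eq_p : forall x t, D (x, t) ->
     kappa * partial_t (partial_t p) x t - partial_t q x t
     + beta * partial_x (partial_x p) x t + U_p x t = 0)
  (eq_q : forall x t, D (x, t) ->
     kappa * partial_t (partial_t q) x t + partial_t p x t
     + beta * partial_x (partial_x q) x t + U_q x t = 0) :
  conservation_law D
    (fun x t => kappa / 2 *
       (- (p x t * partial_x (partial_t p) x t)
        - q x t * partial_x (partial_t q) x t
        + partial_x p x t * partial_t p x t + partial_x q x t * partial_t q x t)
       + 1 / 2 * (p x t * partial_x q x t - q x t * partial_x p x t))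
    (fun x t => U x t
       + beta * ((partial_x p x t ^ 2 + partial_x q x t ^ 2) / 2)
       - 1 / 2 * (p x t * partial_t q x t - q x t * partial_t p x t
                  - kappa * (p x t * partial_t (partial_t p) x t
                             + q x t * partial_t (partial_t q) x t))).
Proof.
  eapply conservation_law_intro.
  - intros x t Dxt; auto_derive; [repeat split; eauto 10 with smooth | reflexivity].
  - intros x t Dxt; auto_derive.
    + repeat split; eauto 10 with smooth; eexists; now apply U_derive_x.
    + replace (Derive (fun y => U y t) x)
        with (U_p x t * partial_x p x t + U_q x t * partial_x q x t)
        by (symmetry; apply is_derive_unique; now apply U_derive_x).
      reflexivity.
  - intros x t Dxt; simpl; fold_partials x t.
    rewrite !(smooth_on_mixed_partials D) by eauto with smooth.
    transitivity
      (partial_x p x t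
         * (kappa * partial_t (partial_t p) x t - partial_t q x t
            + beta * partial_x (partial_x p) x t + U_p x t)
       + partial_x q x t
         * (kappa * partial_t (partial_t q) x t + partial_t p x t
            + beta * partial_x (partial_x q) x t + U_q x t)).
    + field.
    + rewrite (eq_p x t Dxt), (eq_q x t Dxt); ring.
Qed.

Theorem mainTheorem6 (kappa beta : R) (V : R -> R -> R) (f : C -> C)
  (D : R * R -> Prop) (u : R -> R -> C)
  (kappa_gt0 : 0 < kappa) (beta_gt0 : 0 < beta)
  (V_smooth : smooth_on (fun _ => True) V)
  (Re_f : forall p q : R,
     Re (f (RtoC p + Ci * RtoC q)%C) = Derive (fun p' => V p' q) p)
  (Im_f : forall p q : R,
     Im (f (RtoC p + Ci * RtoC q)%C) = Derive (fun q' => V p q') q)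
  (D_open : open D)
  (u_smooth : Csmooth_on D u)
  (u_sol : forall x t : R, D (x, t) ->
     (RtoC kappa * Cpartial_t (Cpartial_t u) x t + Ci * Cpartial_t u x t
      + RtoC beta * Cpartial_x (Cpartial_x u) x t + f (u x t))%C = RtoC 0) :
  let p := fun x t => Re (u x t) in
  let q := fun x t => Im (u x t) in
  let v := partial_x p in
  let w := partial_x q in
  let phi := partial_t p in
  let vphi := partial_t q in
  let E := fun x t =>
    V (p x t) (q x t) + kappa * ((phi x t ^ 2 + vphi x t ^ 2) / 2)
    + beta / 2 * (p x t * partial_x v x t + q x t * partial_x w x t) in
  let F := fun x t =>
    beta / 2 * (v x t * phi x t + w x t * vphi x t
                - p x t * partial_t v x t - q x t * partial_t w x t) in
  let I := fun x t =>
    kappa / 2 * (- (p x t * partial_x phi x t) - q x t * partial_x vphi x t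
                 + v x t * phi x t + w x t * vphi x t)
    + 1 / 2 * (p x t * partial_x q x t - q x t * partial_x p x t) in
  let M := fun x t =>
    V (p x t) (q x t) + beta * ((v x t ^ 2 + w x t ^ 2) / 2)
    - 1 / 2 * (p x t * vphi x t - q x t * phi x t
               - kappa * (p x t * partial_t phi x t + q x t * partial_t vphi x t)) in
  conservation_law D E F /\ conservation_law D I M.
Proof.
  destruct u_smooth as [p_smooth q_smooth].
  intros p q v w phi vphi E F I M.
  assert (real_system : forall x t, D (x, t) ->
    kappa * partial_t phi x t - vphi x t + beta * partial_x v x t
      + partial_x V (p x t) (q x t) = 0 /\
    kappa * partial_t vphi x t + phi x t + beta * partial_x w x t
      + partial_t V (p x t) (q x t) = 0).
  { intros x t Dxt.
    exact (wave_equation_real_system kappa beta V f (u x t)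
             (Cpartial_t (Cpartial_t u) x t) (Cpartial_t u x t)
             (Cpartial_x (Cpartial_x u) x t) (Re_f _ _) (Im_f _ _)
             (u_sol x t Dxt)). }
  split.
  - apply (energy_conservation kappa beta D p q
      (fun x t => V (p x t) (q x t)) (fun x t => partial_x V (p x t) (q x t))
      (fun x t => partial_t V (p x t) (q x t)) D_open p_smooth q_smooth).
    + intros x t Dxt; apply (is_derive_comp_smooth V (p x) (q x) t V_smooth).
      * exact (smooth_on_ex_derive_t D p x t p_smooth Dxt).
      * exact (smooth_on_ex_derive_t D q x t q_smooth Dxt).
    + intros x t Dxt; exact (proj1 (real_system x t Dxt)).
    + intros x t Dxt; exact (proj2 (real_system x t Dxt)).
  - apply (momentum_conservation kappa beta D p q
      (fun x t => V (p x t) (q x t)) (fun x t => partial_x V (p x t) (q x t))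
      (fun x t => partial_t V (p x t) (q x t)) D_open p_smooth q_smooth).
    + intros x t Dxt.
      apply (is_derive_comp_smooth V (fun y => p y t) (fun y => q y t) x V_smooth).
      * exact (smooth_on_ex_derive_x D p x t p_smooth Dxt).
      * exact (smooth_on_ex_derive_x D q x t q_smooth Dxt).
    + intros x t Dxt; exact (proj1 (real_system x t Dxt)).
    + intros x t Dxt; exact (proj2 (real_system x t Dxt)).
Qed.
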